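(* Suppose that an $(n+1)$-dimensional asymptotically AdS space-time is a static solution: $Y^{n+1}=\mathbb{R}\times\Sigma$, $g=-V\,dt^2+h$, where $h$ is a Riemannian metric on the $n$-manifold $\Sigma$, $V>0$ on $\Sigma$, and on $(\Sigma,h)$ $$\Delta\sqrt V=n\sqrt V,\qquad \mathrm{Ric}[h]+n h=(\sqrt V)^{-1}\nabla^2\sqrt V .$$ Then on $(\Sigma,h)$ $$-\Delta\left(V-|\nabla\sqrt V|^2-1\right)=2\left|\nabla^2\sqrt V-\sqrt V\,h\right|^2-\frac{\nabla\sqrt V}{\sqrt V}\cdot\nabla\left(V-|\nabla\sqrt V|^2-1\right).$$
   Context: All norms, inner products, the gradient $\nabla$, the Hessian $\nabla^2$ and the Laplacian $\Delta=\mathrm{tr}_h\nabla^2$ are with respect to $h$. A space-time is a connected smooth manifold with a Lorentzian metric of signature $(-,+,\dots,+)$. Let $n\ge 2$ and let $d\sigma_0$ be the standard round metric on the unit sphere $S^{n-1}$. Defining function and conformal completion: suppose $Y^{n+1}$ is (the interior of) a manifold with boundary $\partial Y=X^n$. A function $\Omega$ is a defining function of $X^n$ in $Y$ if $\Omega>0$ in $Y$, $\Omega=0$ on $X^n$, and $d\Omega\ne0$ on $X^n$. A space-time $(Y^{n+1},g)$ has a $C^k$ conformal completion if $Y$ is a manifold with boundary $X^n$ and $\Omega^2g$, for a defining function $\Omega$, extends in $C^k$ to the closure of $Y$. Asymptotically AdS: $(Y^{n+1},g)$ is asymptotically AdS if (1) it has a $C^k$ conformal completion with boundary $X^n$ topologically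 $\mathbb{R}\times S^{n-1}$; (2) it satisfies $R_{ab}-\frac12Rg_{ab}+\Lambda g_{ab}=8\pi G\,T_{ab}$ with $\Lambda=-\frac{n(n-1)}2$ ($G$ a constant), where $\Omega^{-n}T_{ab}$ admits a $C^k$ extension to the closure of $Y$; (3) $(X^n,\Omega^2g|_{TX^n})$ is conformal to $(\mathbb{R}\times S^{n-1},-dt^2+d\sigma_0)$. *)

(* Defs.v *)
From HB Require Import structures.
From mathcomp Require Import all_boot all_order all_algebra.
From mathcomp Require Import all_classical all_reals all_analysis.
Set Implicit Arguments.
Unset Strict Implicit.
Unset Printing Implicit Defensive.
Import Order.TTheory GRing.Theory Num.Theory.
Import numFieldNormedType.Exports.
Local Open Scope classical_set_scope.
Local Open Scope ring_scope.

(** * Differentiability classes on subsets of R^m *)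

Definition partial (R : realType) (m : nat) (i : 'I_m) (f : 'rV[R]_m -> R)
  : 'rV[R]_m -> R := 'D_(delta_mx 0 i) f.

Fixpoint Ck (R : realType) (m k : nat) (O : set 'rV[R]_m)
    (f : 'rV[R]_m -> R) : Prop :=
  (forall x, O x -> {for x, continuous f}) /\
  match k with
  | 0%N => True
  | k'.+1 => forall i : 'I_m,
      (forall x, O x -> derivable f x (delta_mx 0 i)) /\ Ck k' O (partial i f)
  end.

Definition Cinfty (R : realType) (m : nat) (O : set 'rV[R]_m)
  (f : 'rV[R]_m -> R) : Prop := forall k, Ck k O f.

(* On a subset that need not be open (such as a relatively open subset of a
   half-space), regularity means local extendability to an open set.  On an
   open subset this is the usual notion. *)
Definition Ck_on (R : realType) (m k : nat) (D : set 'rV[R]_m)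
    (f : 'rV[R]_m -> R) : Prop :=
  forall x, D x -> exists (O : set 'rV[R]_m) (F : 'rV[R]_m -> R),
    [/\ open O, O x, Ck k O F & forall y, O y -> D y -> f y = F y].

Definition smooth_on (R : realType) (m : nat) (D : set 'rV[R]_m)
    (f : 'rV[R]_m -> R) : Prop :=
  forall x, D x -> exists (O : set 'rV[R]_m) (F : 'rV[R]_m -> R),
    [/\ open O, O x, Cinfty O F & forall y, O y -> D y -> f y = F y].

(** * Smooth manifolds, possibly with boundary *)

(* An indexed family of coordinate systems on T.  Only the values of [coords c]
   on [dom c], and of its inverse [point_at c] on the image of [dom c], are
   meaningful. *)
Record atlas (R : realType) (T : topologicalType) (m : nat) := Atlas {
  chart : Type;
  dom : chart -> set T;
  coords : chart -> T -> 'rV[R]_m;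
  point_at : chart -> 'rV[R]_m -> T }.

Definition half_space (R : realType) (m : nat) : set 'rV[R]_(1 + m) :=
  [set x | 0 <= x ord0 ord0].

(* T is a smooth manifold modelled on open subsets of H: [H = setT] gives
   manifolds without boundary, [H = half_space R m] manifolds with boundary. *)
Record smooth_manifold (R : realType) (T : topologicalType) (m : nat)
    (H : set 'rV[R]_m) (A : atlas R T m) : Prop := SmoothManifold {
  manifold_hausdorff : hausdorff_space T;
  manifold_second_countable : @second_countable T;
  dom_cover : forall p, exists c, dom (a := A) c p;
  dom_open : forall c, open (dom (a := A) c);
  coords_open : forall c, exists2 O : set 'rV[R]_m,
    open O & coords c @` dom (a := A) c = O `&` H;
  coordsK : forall c p, dom (a := A) c p -> point_at c (coords c p) = p;
  coords_continuous :
    forall c, {within dom (a := A) c, continuous (coords c)};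
  point_at_continuous :
    forall c, {within coords c @` dom (a := A) c, continuous (point_at c)};
  transition_smooth : forall (c c' : chart A) (j : 'I_m),
    smooth_on (coords c @` (dom c `&` dom c'))
      (fun x => coords c' (point_at c x) 0 j) }.

Definition bdry (R : realType) (T : topologicalType) (m : nat)
    (A : atlas R T (1 + m)) : set T :=
  [set p | exists2 c : chart A, dom c p & coords c p ord0 ord0 = 0].

Definition interior_pts (R : realType) (T : topologicalType) (m : nat)
  (A : atlas R T (1 + m)) : set T := ~` bdry A.

(* The atlas of the boundary, kept on the ambient type: forget the coordinate
   of index 0. *)
Definition bdry_atlas (R : realType) (T : topologicalType) (m : nat)
    (A : atlas R T (1 + m)) : atlas R T m :=
  {| chart := chart A;
     dom := fun c => dom c `&` bdry A;
     coords := fun c p => rsubmx (coords c p);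
     point_at := fun c y => point_at c (row_mx 0 y) |}.

(* R x T, with the coordinate t of index 0. *)
Definition time_product (R : realType) (T : topologicalType) (m : nat)
    (A : atlas R T m) : atlas R (R * T)%type (1 + m) :=
  {| chart := chart A;
     dom := fun c => [set q | dom c q.2];
     coords := fun c q => row_mx (q.1)%:M (coords c q.2);
     point_at := fun c x => (x ord0 ord0, point_at c (rsubmx x)) |}.

Definition smooth_fun (R : realType) (T : topologicalType) (m : nat)
    (A : atlas R T m) (f : T -> R) : Prop :=
  forall c : chart A, smooth_on (coords c @` dom c) (f \o point_at c).

Definition smooth_map (R : realType) (T1 T2 : topologicalType) (m1 m2 : nat)
    (A1 : atlas R T1 m1) (D : set T1) (A2 : atlas R T2 m2) (f : T1 -> T2)
    : Prop :=
  {within D, continuous f} /\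
  forall (c1 : chart A1) (c2 : chart A2) (j : 'I_m2),
    smooth_on (coords c1 @` (D `&` dom c1 `&` f @^-1` dom c2))
      (fun x => coords c2 (f (point_at c1 x)) 0 j).

(** * Covariant 2-tensors *)

(* [g c p] is the matrix of components of g at p in the coordinates [c]. *)
Definition tensor2 (R : realType) (T : topologicalType) (m : nat)
  (A : atlas R T m) : Type := chart A -> T -> 'M[R]_m.

(* On D, g1 is the pull-back of g2 by f.  With mathcomp's row-vector
   convention ['J F x] has the entries d_i F_j. *)
Definition pulls_back (R : realType) (T1 T2 : topologicalType) (m1 m2 : nat)
    (A1 : atlas R T1 m1) (D : set T1) (A2 : atlas R T2 m2) (f : T1 -> T2)
    (g2 : tensor2 A2) (g1 : tensor2 A1) : Prop :=
  forall c1 c2 p, D p -> dom c1 p -> dom c2 (f p) ->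
    let J := 'J (fun x => coords c2 (f (point_at c1 x))) (coords c1 p) in
    g1 c1 p = J *m g2 c2 (f p) *m J^T.

(* The transformation law under changes of coordinates. *)
Definition tensor_law (R : realType) (T : topologicalType) (m : nat)
    (A : atlas R T m) (D : set T) (g : tensor2 A) : Prop :=
  pulls_back D id g g.

Definition smooth_tensor (R : realType) (T : topologicalType) (m : nat)
    (A : atlas R T m) (g : tensor2 A) : Prop :=
  tensor_law setT g /\
  forall (c : chart A) (i j : 'I_m),
    smooth_on (coords c @` dom c) (fun x => g c (point_at c x) i j).

(* On a manifold with boundary the law is imposed at interior points only,
   where the Jacobian of the transition maps does not see the values of the
   charts outside of the half-space; it passes to the boundary by continuity
   of the components. *)
Definition Ck_tensor (R : realType) (T : topologicalType) (m k : nat)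
    (A : atlas R T (1 + m)) (g : tensor2 A) : Prop :=
  tensor_law (interior_pts A) g /\
  forall (c : chart A) (i j : 'I_(1 + m)),
    Ck_on k (coords c @` dom c) (fun x => g c (point_at c x) i j).

Definition riemannian (R : realType) (T : topologicalType) (m : nat)
    (A : atlas R T m) (g : tensor2 A) : Prop :=
  smooth_tensor g /\
  forall c p, dom c p -> (g c p)^T = g c p /\
    forall v : 'rV[R]_m, v != 0 -> 0 < (v *m g c p *m v^T) 0 0.

Definition minkowski (R : realType) (m : nat) : 'M[R]_(1 + m) :=
  block_mx (- 1%:M) 0 0 1%:M.

Definition lorentzian (R : realType) (T : topologicalType) (m : nat)
    (A : atlas R T (1 + m)) (g : tensor2 A) : Prop :=
  smooth_tensor g /\
  forall c p, dom c p -> exists2 P : 'M[R]_(1 + m),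
    P \in unitmx & P *m g c p *m P^T = minkowski R m.

Definition spacetime (R : realType) (T : topologicalType) (m : nat)
    (A : atlas R T (1 + m)) (g : tensor2 A) : Prop :=
  [/\ smooth_manifold setT A, connected [set: T] & lorentzian g].

Definition static_metric (R : realType) (T : topologicalType) (m : nat)
    (A : atlas R T m) (V : T -> R) (h : tensor2 A)
    : tensor2 (time_product A) :=
  fun c q => block_mx (- (V q.2)%:M) 0 0 (h c q.2).

(** * Levi-Civita calculus in the coordinates [c] *)

Section Calculus.
Variables (R : realType) (T : topologicalType) (m : nat) (A : atlas R T m).
Variables (g : tensor2 A) (c : chart A).
Implicit Types (f u v : T -> R) (i j k l s : 'I_m) (p : T).

(* the coordinate vector field d/dx^i applied to f *)
Definition pd i f p : R := partial i (f \o point_at c) (coords c p).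

Definition metric_inv p : 'M[R]_m := invmx (g c p).

(* Gamma^k_ij *)
Definition christoffel k i j p : R :=
  2^-1 * \sum_l metric_inv p k l *
    (pd i (fun q => g c q j l) p + pd j (fun q => g c q i l) p
     - pd l (fun q => g c q i j) p).

(* R^l_kij, the l-component of
   (nabla_i nabla_j - nabla_j nabla_i) (d/dx^k) *)
Definition riemann l k i j p : R :=
  pd i (christoffel l j k) p - pd j (christoffel l i k) p
  + \sum_s (christoffel l i s p * christoffel s j k p
            - christoffel l j s p * christoffel s i k p).

Definition ricci p : 'M[R]_m := \matrix_(k, j) \sum_i riemann i k i j p.

Definition metric_trace (B : 'M[R]_m) p : R :=
  \sum_i \sum_j metric_inv p i j * B i j.

Definition scalar_curvature p : R := metric_trace (ricci p) p.

Definition hessian u p : 'M[R]_m :=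
  \matrix_(i, j) (pd i (pd j u) p - \sum_k christoffel k i j p * pd k u p).

Definition laplacian u p : R := metric_trace (hessian u p) p.

(* the inner product of the gradients of u and v *)
Definition grad_dot u v p : R :=
  \sum_i \sum_j metric_inv p i j * pd i u p * pd j v p.

Definition tensor_normsq (B : 'M[R]_m) p : R :=
  \sum_i \sum_j \sum_k \sum_l
    metric_inv p i k * metric_inv p j l * B i j * B k l.

End Calculus.

(** * Conformal completions and asymptotically AdS space-times *)

(* Y is identified with the interior of Ybar by a diffeomorphism.  The
   condition that the differential of Omega does not vanish on the boundary is
   expressed on smooth local extensions of Omega across the boundary. *)
Record conformal_completion (R : realType) (Y : topologicalType) (m k : nat)
    (A : atlas R Y (1 + m)) (g : tensor2 A) := ConformalCompletion {
  Ybar : topologicalType;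
  Abar : atlas R Ybar (1 + m);
  Ybar_manifold : smooth_manifold (half_space (R := R) (m := m)) Abar;
  incl : Y -> Ybar;
  incl_inv : Ybar -> Y;
  incl_interior : forall y, interior_pts Abar (incl y);
  inclK : cancel incl incl_inv;
  incl_invK : forall p, interior_pts Abar p -> incl (incl_inv p) = p;
  incl_smooth : smooth_map A setT Abar incl;
  incl_inv_smooth : smooth_map Abar (interior_pts Abar) A incl_inv;
  Omega : Ybar -> R;
  Omega_smooth : smooth_fun Abar Omega;
  Omega_gt0 : forall p, interior_pts Abar p -> 0 < Omega p;
  Omega_eq0 : forall p, bdry Abar p -> Omega p = 0;
  dOmega_neq0 : forall (c : chart Abar) p, dom c p -> bdry Abar p ->
    exists (O : set 'rV[R]_(1 + m)) (F : 'rV[R]_(1 + m) -> R),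
      [/\ open O, O (coords c p), Cinfty O F,
          forall y, O y -> (coords c @` dom c) y -> Omega (point_at c y) = F y
        & exists i, partial i F (coords c p) != 0];
  ghat : tensor2 Abar;
  ghat_Ck : Ck_tensor k ghat;
  ghat_incl : pulls_back setT incl ghat
    (fun c y => Omega (incl y) ^+ 2 *: g c y) }.
Arguments incl {R Y m k A g} C _ : rename.
Arguments Omega {R Y m k A g} C _ : rename.
Arguments ghat {R Y m k A g} C _ _ : rename.

Definition unit_sphere (R : realType) (n : nat) : set 'rV[R]_n :=
  [set x | \sum_i x 0 i ^+ 2 = 1].

Definition cylinder (R : realType) (n : nat) : set (R * 'rV[R]_n) :=
  [set z | unit_sphere z.2].

Definition homeomorphism_on (S T : topologicalType) (X : set S) (Z : set T)
    (f : S -> T) : Prop :=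
  {within X, continuous f} /\ f @` X = Z /\
  exists f' : T -> S, {within Z, continuous f'} /\
    forall p, X p -> f' (f p) = p.

(* The pull-back of - dt^2 + dsigma_0 by a map into the cylinder.  The round
   metric dsigma_0 is the restriction to the unit sphere of the Euclidean
   metric of R^n, so that it pulls back to the sum of the squares of the
   differentials of the Euclidean coordinates. *)
Definition pullback_cylinder (R : realType) (T : topologicalType) (m n : nat)
    (A : atlas R T m) (f : T -> R * 'rV[R]_n) : tensor2 A :=
  fun c p => \matrix_(i, j)
    (- (pd c i (fun q => (f q).1) p * pd c j (fun q => (f q).1) p)
     + \sum_(a < n) pd c i (fun q => (f q).2 0 a) p
                  * pd c j (fun q => (f q).2 0 a) p).

(* A smooth homeomorphism onto the cylinder whose differential is injective is
   a diffeomorphism. *)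
Definition conformal_to_cylinder (R : realType) (T : topologicalType)
    (m : nat) (A : atlas R T (1 + m)) (g : tensor2 A) : Prop :=
  exists (f : T -> R * 'rV[R]_m) (w : T -> R),
  [/\ homeomorphism_on (bdry A) (cylinder (n := m)) f,
      smooth_fun (bdry_atlas A) (fun q => (f q).1) /\
        (forall a, smooth_fun (bdry_atlas A) (fun q => (f q).2 0 a)),
      forall p, bdry A p -> 0 < w p
    & forall (c : chart (bdry_atlas A)) p, dom c p ->
        row_free (row_mx
          (\col_i pd c i (fun q => (f q).1) p)
          (\matrix_(i, a) pd c i (fun q => (f q).2 0 a) p)) /\
        drsubmx (g c p) = w p *: pullback_cylinder f c p].

(* R_ab - R g_ab / 2 + Lambda g_ab = 8 pi G T_ab,
   with Lambda = - n (n - 1) / 2 *)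
Definition einstein_equations (R : realType) (Y : topologicalType) (n : nat)
    (A : atlas R Y (1 + n)) (G : R) (g T : tensor2 A) : Prop :=
  forall c p, dom c p ->
    ricci g c p - (scalar_curvature g c p / 2) *: g c p
      + (- (n%:R * (n%:R - 1) / 2)) *: g c p
    = (8 * pi * G) *: T c p.

Definition asymptotically_AdS (R : realType) (Y : topologicalType)
    (n k : nat) (A : atlas R Y (1 + n)) (G : R) (g : tensor2 A) : Prop :=
  spacetime g /\
  exists C : conformal_completion k g,
  [/\ exists f, homeomorphism_on (bdry (Abar C)) (cylinder (R := R) (n := n)) f,
      exists T : tensor2 A,
        [/\ tensor_law setT T,
            einstein_equations G g T
          & exists2 T' : tensor2 (Abar C), Ck_tensor k T' &
              pulls_back setT (incl C) T'
                (fun c y => Omega C (incl C y) ^- n *: T c y)]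
    & conformal_to_cylinder (ghat C)].

(* Main.v *)
Require Import Defs.
From mathcomp Require Import all_boot all_order all_algebra.
From mathcomp Require Import all_classical all_reals all_analysis.
From mathcomp Require Import ring.
Import Order.TTheory GRing.Theory Num.Theory.
Import numFieldNormedType.Exports.
Local Open Scope classical_set_scope.
Local Open Scope ring_scope.
Set Implicit Arguments.
Unset Strict Implicit.
Unset Printing Implicit Defensive.

(* Write u = sqrt V, X = grad u and E_l^m = nabla_l X^m, which is the Hessian
   of u with one index raised.  For W = u^2 - |X|^2 - 1 one finds
   grad W = 2 u X - 2 E X, because the Hessian is symmetric.  The divergence
   of grad W contains nabla_l E_s^l X^s, which the traced Ricci identity
   nabla_l E_s^l = d_s (Delta u) + Ric_ts X^t turns into
   n |X|^2 + Ric(X, X), and the static equation expresses Ric(X, X) through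
   Hess u (X, X).  The remaining terms are matched by
   |Hess u - u h|^2 = tr E^2 - 2 u Delta u + n u^2 = tr E^2 - n u^2. *)

(** * Commutation of directional derivatives *)

(** Of the two static equations only [Delta u = n u] is differentiated: it turns the pairing of
    [grad (Delta u)] with [X] into [n |X|^2], which cancels the [- n |X|^2] inside
    [Ric(X, X) = u^-1 Hess u (X, X) - n |X|^2]. The first-order remainder
    [2 |X|^2 - 2 u^-1 Hess u (X, X)] is exactly [u^-1 X . grad W]; this is where the drift term of
    the theorem comes from. The obstacle is that all tensors are arrays of components in a chart, so
    a covariant identity is an identity between partial derivatives and Christoffel symbols. Its
    non-tensorial terms cancel through two facts: the symbols are symmetric in their lower indices,
    and the inverse metric is parallel. Moreover [Ck] provides only continuous iterated directional
    derivatives, so the symmetry of mixed partials needs a proof, and every product rule needs the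
    smoothness of the factors in the chart. *)

Section DirectionalDerivative.
Variables (R : realType) (V : normedModType R).
Implicit Types (f : V -> R) (v w x : V).

(** The two difference quotients are the same function, so results on one real variable apply
    without Frechet differentiability of [f]. *)
Lemma is_derive_along_line f x v t d :
  is_derive (t *: v + x) v f d -> is_derive t 1 (fun s : R => f (s *: v + x)) d.
Proof.
move=> [df <-]; rewrite /derivable in df.
have E : (fun h => h^-1 *: ((f \o shift (t *: v + x)) (h *: v) - f (t *: v + x)))
    = (fun h => h^-1 *: (((fun s : R => f (s *: v + x)) \o shift t) (h *: 1)
         - f (t *: v + x))).
  by apply/funext => s /=; rewrite [_%:A]mulr1 scalerDl addrA.
by split; rewrite /derivable /derive -E.
Qed.

Lemma derive_along_line f x v t : derivable f (t *: v + x) v ->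
  is_derive t 1 (fun s : R => f (s *: v + x)) ('D_v f (t *: v + x)).
Proof. by move=> df; exact/is_derive_along_line/derivableP. Qed.

Lemma is_derive_of_line f x v d :
  is_derive (0 : R) 1 (fun s : R => f (s *: v + x)) d -> is_derive x v f d.
Proof.
move=> [df <-]; split; first exact/derivable1P.
rewrite /derive.
have -> : (fun h => h^-1 *: (((fun s : R => f (s *: v + x)) \o shift (0 : R)) (h *: 1)
         - f (0 *: v + x))) = (fun h => h^-1 *: ((f \o shift x) (h *: v) - f x)).
  by apply/funext => s /=; rewrite [_%:A]mulr1 addr0 scale0r add0r.
by [].
Qed.

(** Chain rule on the line through [x], since [f] is only known to be derivable in the direction
    [v]. *)
Lemma is_derive_sqrt f x v d : 0 < f x -> is_derive x v f d ->
  is_derive x v (fun y => Num.sqrt (f y)) ((2 * Num.sqrt (f x))^-1 * d).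
Proof.
move=> fx0 df; apply: is_derive_of_line.
have dl : is_derive (0 : R) 1 (fun s : R => f (s *: v + x)) d.
  by apply: is_derive_along_line; rewrite scale0r add0r.
have := @is_derive1_comp R Num.sqrt _ 0 (2 * Num.sqrt (f x))^-1 d _ dl.
apply; rewrite scale0r add0r; exact: is_derive1_sqrt.
Qed.

(** The mean value theorem is applied twice: along [v] to the increment of [f] under the shift by
    [e *: w], then along [w] to ['D_v f]. The point obtained is not controlled beyond lying in the
    parallelogram, which is enough once the mixed derivatives are continuous. *)
Lemma second_difference_mvt f x v w (e : R) : 0 < e ->
  (forall s t, 0 <= s <= e -> 0 <= t <= e ->
     derivable f (x + s *: v + t *: w) v /\
     derivable ('D_v f) (x + s *: v + t *: w) w) ->
  exists s t, [/\ 0 <= s <= e, 0 <= t <= e &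
    f (x + e *: v + e *: w) - f (x + e *: v) - f (x + e *: w) + f x
    = e * e * 'D_w ('D_v f) (x + s *: v + t *: w)].
Proof.
move=> e0 df.
have eI : 0 <= e <= e by rewrite lexx ltW.
have zI : (0 : R) <= 0 <= e by rewrite lexx ltW.
pose phi (s : R) := f (s *: v + (x + e *: w)) - f (s *: v + x).
pose dphi (s : R) := 'D_v f (s *: v + (x + e *: w)) - 'D_v f (s *: v + x).
have dphiE s : 0 <= s <= e -> is_derive s 1 phi (dphi s).
  move=> se; apply: is_deriveB; apply: derive_along_line.
    have -> : s *: v + (x + e *: w) = x + s *: v + e *: w by rewrite addrCA addrA.
    by case: (df s e se eI) => d1 _; exact: d1.
  by case: (df s 0 se zI); rewrite scale0r addr0 addrC => d1 _; exact: d1.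
have [s sI Es] : exists2 s, s \in `]0, e[ & phi e - phi 0 = dphi s * (e - 0).
  apply: (@MVT _ phi dphi _ _ e0).
    by move=> s; rewrite in_itv/= => /andP[s0 se]; apply: dphiE; rewrite !ltW.
  apply: derivable_within_continuous => s; rewrite in_itv/= => se.
  by case: (dphiE s se) => d1 _; exact: d1.
have {}sI : 0 <= s <= e by move: sI; rewrite in_itv/= => /andP[s0 se]; rewrite !ltW.
pose psi (t : R) := 'D_v f (t *: w + (x + s *: v)).
pose dpsi (t : R) := 'D_w ('D_v f) (t *: w + (x + s *: v)).
have dpsiE t : 0 <= t <= e -> is_derive t 1 psi (dpsi t).
  move=> te; apply: derive_along_line.
  by case: (df s t sI te); rewrite addrC => _ d2; exact: d2.
have [t tI Et] : exists2 t, t \in `]0, e[ & psi e - psi 0 = dpsi t * (e - 0).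
  apply: (@MVT _ psi dpsi _ _ e0).
    by move=> t; rewrite in_itv/= => /andP[t0 te]; apply: dpsiE; rewrite !ltW.
  apply: derivable_within_continuous => t; rewrite in_itv/= => te.
  by case: (dpsiE t te) => d1 _; exact: d1.
have {}tI : 0 <= t <= e by move: tI; rewrite in_itv/= => /andP[t0 te]; rewrite !ltW.
exists s, t; split=> //.
have E1 : dphi s = psi e - psi 0.
  rewrite /dphi /psi scale0r add0r [s *: v + x]addrC; congr ('D_v f _ - _).
  by rewrite addrCA [RHS]addrCA (addrC (s *: v)).
move: Es; rewrite E1 Et subr0 /dpsi [t *: w + _]addrC /phi !scale0r !add0r.
have -> : e *: v + (x + e *: w) = x + e *: v + e *: w by rewrite addrCA addrA.
rewrite [e *: v + x]addrC => Es.
have -> : e * e * 'D_w ('D_v f) (x + s *: v + t *: w)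
   = 'D_w ('D_v f) (x + s *: v + t *: w) * e * e by ring.
rewrite -Es; ring.
Qed.

(** The second difference is symmetric in [v] and [w], so for small [e] both mixed derivatives take
    a common value at points near [x]. If their values at [x] differed, this common value would lie
    within half their distance of each. *)
Lemma derive_comm f x v w :
  (\forall y \near x, derivable f y v /\ derivable f y w) ->
  (\forall y \near x, derivable ('D_v f) y w /\ derivable ('D_w f) y v) ->
  {for x, continuous ('D_w ('D_v f))} ->
  {for x, continuous ('D_v ('D_w f))} ->
  'D_w ('D_v f) x = 'D_v ('D_w f) x.
Proof.
have far (a b c : R) : `|a - c| < `|a - b| / 2 -> `|b - c| < `|a - b| / 2 -> False.
  move=> lt1 lt2; have lt3 : `|a - c| + `|c - b| < `|a - b|.
    by rewrite [X in _ < X]splitr (distrC c b) ltrD.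
  by have := lt_le_trans lt3 (ler_distD c a b); rewrite ltxx.
move=> d1 d2 c1 c2; apply/eqP/negPn/negP => neq.
set a := 'D_w ('D_v f) x in neq; set b := 'D_v ('D_w f) x in neq.
have ab0 : 0 < `|a - b| / 2 by rewrite divr_gt0 ?normr_gt0 ?subr_eq0.
have /cvgrPdist_lt/(_ _ ab0) near1 := c1.
have /cvgrPdist_lt/(_ _ ab0) near2 := c2.
have : \forall y \near x, [/\ derivable f y v /\ derivable f y w,
   derivable ('D_v f) y w /\ derivable ('D_w f) y v,
   `|a - 'D_w ('D_v f) y| < `|a - b| / 2 &
   `|b - 'D_v ('D_w f) y| < `|a - b| / 2].
  apply: filterS (filterI (filterI d1 d2) (filterI near1 near2)).
  by move=> y [[d1y d2y] [n1y n2y]];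
  split; [exact: d1y|exact: d2y|exact: n1y|exact: n2y].
move=> /nbhs_normP[r /= r0 near_r].
(* The summand 1 keeps the denominator positive when [v = w = 0] and makes the parallelogram fit
   strictly inside the ball of radius [r]. *)
pose e := r / (`|v| + `|w| + 1).
have vw0 : 0 < `|v| + `|w| + 1 by rewrite ltr_wpDl ?addr_ge0.
have e0 : 0 < e by rewrite divr_gt0.
have in_r s t : 0 <= s <= e -> 0 <= t <= e ->
    ball_ (fun y => `|y|) x r (x + s *: v + t *: w).
  move=> /andP[s0 se] /andP[t0 te]; rewrite /ball_/=.
  rewrite -addrA opprD addNKr normrN (le_lt_trans (ler_normD _ _))//.
  rewrite !normrZ !ger0_norm//.
  have : s * `|v| + t * `|w| <= e * (`|v| + `|w|) by rewrite mulrDr lerD ?ler_wpM2r.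
  move/le_lt_trans; apply.
  by rewrite /e mulrAC ltr_pdivrMr// ltr_pM2l// ltrDl.
have [|s [t [sI tI Es]]] := @second_difference_mvt f x v w e e0.
  by move=> s t sI tI; have [[? ?] [? ?] _ _] := near_r _ (in_r s t sI tI).
have [|t' [s' [tI' sI' Et]]] := @second_difference_mvt f x w v e e0.
  move=> s' t' sI' tI'; rewrite addrAC.
  by have [[? ?] [? ?] _ _] := near_r _ (in_r t' s' tI' sI').
have [_ _ lt1 _] := near_r _ (in_r s t sI tI).
have [_ _ _] := near_r _ (in_r s' t' sI' tI').
rewrite addrAC => lt2.
have ee : e * e != 0 by rewrite mulf_neq0 // gt_eqF.
have eqD : 'D_w ('D_v f) (x + s *: v + t *: w) = 'D_v ('D_w f) (x + t' *: w + s' *: v).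
  apply: (mulfI ee); apply: etrans (etrans (esym Es) _) Et.
  by rewrite [x + e *: v + _]addrAC; congr (_ + _); exact: addrAC.
by rewrite eqD in lt1; exact: far lt1 lt2.
Qed.

End DirectionalDerivative.

(** * Smooth functions on open sets *)

Section SmoothFunctions.
Variables (R : realType) (m : nat).
Implicit Types (O : set 'rV[R]_m) (f g : 'rV[R]_m -> R) (k : nat).

(** Derivatives depend only on germs, so the local extensions that define [smooth_on] give back
    ordinary regularity on an open set. *)
Lemma Ck_local k O f : open O ->
  (forall x, O x -> exists U F,
     [/\ open U, U x, Ck k U F & forall y, U y -> O y -> f y = F y]) ->
  Ck k O f.
Proof.
move=> openO.
have near_fF g x U F : open U -> U x -> O x ->
    (forall y, U y -> O y -> g y = F y) -> \forall y \near x, F y = g y.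
  move=> openU Ux Ox gF.
  have : \forall y \near x, U y /\ O y.
    by apply: filterI; apply: open_nbhs_nbhs.
  by apply: filterS => y [Uy Oy]; rewrite gF.
have cont g x U F : open U -> U x -> O x ->
    (forall y, U y -> O y -> g y = F y) ->
    {for x, continuous F} -> {for x, continuous g}.
  move=> openU Ux Ox gF cF; rewrite /prop_for/continuous_at (gF _ Ux Ox).
  exact: cvg_trans (near_eq_cvg (near_fF _ _ _ _ openU Ux Ox gF)) cF.
elim: k f => [|k IH] f loc.
  split=> // x Ox; have [U [F [openU Ux [cF _] fF]]] := loc x Ox.
  by apply: (cont f x U F) => //; exact: cF.
split=> [x Ox|i].
  have [U [F [openU Ux [cF _] fF]]] := loc x Ox.
  by apply: (cont f x U F) => //; exact: cF.
split=> [x Ox|].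
  have [U [F [openU Ux [_ dF] fF]]] := loc x Ox.
  have [/(_ _ Ux) dFx _] := dF i.
  exact: near_eq_derivable (near_fF f x U F openU Ux Ox fF) dFx.
apply: IH => // x Ox; have [U [F [openU Ux [_ dF] fF]]] := loc x Ox.
have [_ CF] := dF i.
exists U, (partial i F); split => // y Uy Oy.
rewrite /partial; symmetry; apply: near_eq_derive.
exact: near_fF fF.
Qed.

Lemma eq_Ck k O f g : open O -> (forall x, O x -> f x = g x) ->
  Ck k O f -> Ck k O g.
Proof.
move=> openO fg Cf; apply: Ck_local => // x Ox.
by exists O, f; split=> // y Oy _; rewrite fg.
Qed.

Lemma CkW k O f : Ck k.+1 O f -> Ck k O f.
Proof.
elim: k f => [|k IH] f [cf df]; split=> // i; have [dfi Cfi] := df i.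
by split=> //; exact: IH.
Qed.

Lemma Ck_cst k O (a : R) : Ck k O (cst a).
Proof.
elim: k a => [|k IH] a; (split=> [x _|]; first exact: cst_continuous) => //.
move=> i; split=> [x _|]; first exact: derivable_cst.
rewrite (_ : partial i _ = cst 0); first exact: IH.
by apply/funext => x; exact: derive_cst.
Qed.

Lemma CkD k O f g : open O -> Ck k O f -> Ck k O g -> Ck k O (fun x => f x + g x).
Proof.
move=> openO; elim: k f g => [|k IH] f g [cf df] [cg dg].
  by split=> // x Ox; apply: continuousD; [exact: cf|exact: cg].
split=> [x Ox|i]; first by apply: continuousD; [exact: cf|exact: cg].
have [dfi Cfi] := df i; have [dgi Cgi] := dg i; split=> [x Ox|].
  by apply: derivableD; [exact: dfi|exact: dgi].
apply: eq_Ck (IH _ _ Cfi Cgi) => // x Ox.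
by symmetry; apply: deriveD; [exact: dfi|exact: dgi].
Qed.

Lemma CkM k O f g : open O -> Ck k O f -> Ck k O g -> Ck k O (fun x => f x * g x).
Proof.
move=> openO; elim: k f g => [|k IH] f g Cf Cg.
  have [cf _] := Cf; have [cg _] := Cg.
  by split=> // x Ox; apply: continuousM; [exact: cf|exact: cg].
have [cf df] := Cf; have [cg dg] := Cg.
split=> [x Ox|i]; first by apply: continuousM; [exact: cf|exact: cg].
have [dfi Cfi] := df i; have [dgi Cgi] := dg i; split=> [x Ox|].
  by apply: derivableM; [exact: dfi|exact: dgi].
apply: eq_Ck (CkD openO (IH _ _ (CkW Cf) Cgi) (IH _ _ (CkW Cg) Cfi)) => // x Ox.
by symmetry; apply: deriveM; [exact: dfi|exact: dgi].
Qed.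

Lemma CkV k O f : open O -> (forall x, O x -> f x != 0) ->
  Ck k O f -> Ck k O (fun x => (f x)^-1).
Proof.
move=> openO f0; elim: k => [|k IH] Cf; have [cf df] := Cf.
  by split=> // x Ox; apply: continuousV; [exact: f0|exact: cf].
split=> [x Ox|i]; first by apply: continuousV; [exact: f0|exact: cf].
have [dfi Cfi] := df i; split=> [x Ox|].
  by apply: derivableV; [exact: f0|exact: dfi].
have CV := IH (CkW Cf).
apply: eq_Ck (CkM openO (CkM openO (Ck_cst k O (-1)) (CkM openO CV CV)) Cfi) => // x Ox.
rewrite /partial deriveV; [|exact: f0|exact: dfi].
by rewrite mulN1r expr2 invfM.
Qed.

(** The derivative of the root contains the root itself, one order lower, so induction on [k] closes
    with [CkV] and [CkM]. *)
Lemma Ck_sqrt k O f : open O -> (forall x, O x -> 0 < f x) ->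
  Ck k O f -> Ck k O (fun x => Num.sqrt (f x)).
Proof.
move=> openO f0.
have cs x : O x -> {for x, continuous f} -> {for x, continuous (fun y => Num.sqrt (f y))}.
  by move=> Ox cf; apply: continuous_comp => //; exact: sqrt_continuous.
elim: k => [|k IH] Cf; have [cf df] := Cf.
  by split=> // x Ox; apply: cs => //; exact: cf.
split=> [x Ox|i]; first by apply: cs => //; exact: cf.
have [dfi Cfi] := df i.
have ds x : O x -> is_derive x (delta_mx 0 i) (fun y => Num.sqrt (f y))
    ((2 * Num.sqrt (f x))^-1 * partial i f x).
  move=> Ox; apply: is_derive_sqrt; first exact: f0.
  exact/derivableP/dfi.
split=> [x Ox|]; first by case: (ds x Ox) => d _; exact: d.
apply: (@eq_Ck k O (fun x => (2 * Num.sqrt (f x))^-1 * partial i f x)) => //.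
  by move=> x Ox; case: (ds x Ox) => _ <-.
apply: CkM => //; apply: CkV => // [x Ox|].
  by rewrite mulf_neq0// gt_eqF// sqrtr_gt0 f0.
by apply: CkM => //; [exact: Ck_cst|exact/IH/CkW].
Qed.

Lemma Ck2_partialC O f i j : open O -> Ck 2 O f -> forall x, O x ->
  partial i (partial j f) x = partial j (partial i f) x.
Proof.
move=> openO [_ Cf] x Ox.
have [di [_ Ci]] := Cf i; have [dj [_ Cj]] := Cf j.
have [dij [cij _]] := Ci j; have [dji [cji _]] := Cj i.
have near_O : \forall y \near x, O y by exact: open_nbhs_nbhs.
apply: derive_comm; [| |exact: cji|exact: cij].
- by apply: filterS near_O => y Oy; split; [exact: dj|exact: di].
- by apply: filterS near_O => y Oy; split; [exact: dji|exact: dij].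
Qed.

End SmoothFunctions.

(** * Smooth functions in a chart *)

Section ChartSmooth.
Variables (R : realType) (T : topologicalType) (n : nat) (A : atlas R T n).
Hypothesis manA : smooth_manifold setT A.
Variable c : chart A.
Implicit Types (f g : T -> R) (p q : T) (i j k : 'I_n).

Let O := coords c @` dom c.

Definition chart_smooth f := Cinfty O (f \o point_at c).

Lemma open_coords_image : open O.
Proof. by have [U openU] := coords_open manA c; rewrite setIT /O => ->. Qed.

Lemma smooth_on_chart_smooth f : smooth_on O (f \o point_at c) -> chart_smooth f.
Proof.
move=> sf k; apply: Ck_local => [|x Ox]; first exact: open_coords_image.
by have [U [F [openU Ux CF fF]]] := sf x Ox; exists U, F; split.
Qed.

Lemma point_atK p : dom c p -> point_at c (coords c p) = p.
Proof. exact: (coordsK manA). Qed.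

Lemma eq_on_coords f g : (forall q, dom c q -> f q = g q) ->
  forall x, O x -> (f \o point_at c) x = (g \o point_at c) x.
Proof. by move=> fg _ [q cq <-] /=; rewrite point_atK// fg. Qed.

Lemma near_coords p : dom c p -> \forall x \near coords c p, O x.
Proof.
by move=> cp; apply: open_nbhs_nbhs; split; [exact: open_coords_image|exists p].
Qed.

Lemma eq_chart_smooth f g : (forall q, dom c q -> f q = g q) ->
  chart_smooth f -> chart_smooth g.
Proof.
move=> fg sf k; apply: eq_Ck (sf k); first exact: open_coords_image.
exact: eq_on_coords.
Qed.

(** Equations that hold on the chart domain only, such as the symmetry of the metric or the Laplace
    equation, may be differentiated because the image of the domain is open. *)
Lemma eq_pd f g p i : (forall q, dom c q -> f q = g q) -> dom c p ->
  pd c i f p = pd c i g p.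
Proof.
move=> fg cp; rewrite /pd /partial; apply: near_eq_derive.
by apply: filterS (near_coords cp) => x; exact: eq_on_coords.
Qed.

Lemma pd_chart f i q : dom c q ->
  (pd c i f \o point_at c) (coords c q) = partial i (f \o point_at c) (coords c q).
Proof. by move=> cq; rewrite /pd /= point_atK. Qed.

Lemma chart_smooth_derivable f p i : chart_smooth f -> dom c p ->
  derivable (f \o point_at c) (coords c p) (delta_mx 0 i).
Proof. by move=> /(_ 1)[_ /(_ i)[df _]] cp; apply: df; exists p. Qed.

Lemma chart_smooth_pd f i : chart_smooth f -> chart_smooth (pd c i f).
Proof.
move=> sf k; have [_ /(_ i)[_ Cf]] := sf k.+1.
apply: eq_Ck Cf; first exact: open_coords_image.
by move=> _ [q cq <-]; rewrite pd_chart.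
Qed.

Lemma pdC f p i j : chart_smooth f -> dom c p ->
  pd c i (pd c j f) p = pd c j (pd c i f) p.
Proof.
move=> sf cp.
have E k l : pd c k (pd c l f) p
    = partial k (partial l (f \o point_at c)) (coords c p).
  apply: near_eq_derive; apply: filterS (near_coords cp).
  by move=> _ [q cq <-]; rewrite pd_chart.
rewrite (E i j) (E j i).
have Op : O (coords c p) by exists p.
exact: (Ck2_partialC i j open_coords_image (sf 2%N) Op).
Qed.

Lemma chart_smooth_cst a : chart_smooth (fun=> a).
Proof. by move=> k; exact: Ck_cst. Qed.

Lemma chart_smoothD f g : chart_smooth f -> chart_smooth g ->
  chart_smooth (fun q => f q + g q).
Proof. by move=> sf sg k; apply: (CkD open_coords_image (sf k) (sg k)). Qed.

Lemma chart_smoothM f g : chart_smooth f -> chart_smooth g ->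
  chart_smooth (fun q => f q * g q).
Proof. by move=> sf sg k; apply: (CkM open_coords_image (sf k) (sg k)). Qed.

Lemma chart_smoothN f : chart_smooth f -> chart_smooth (fun q => - f q).
Proof.
move=> sf; apply: eq_chart_smooth (chart_smoothM (chart_smooth_cst (-1)) sf) => q _.
by rewrite mulN1r.
Qed.

Lemma chart_smoothV f : (forall q, dom c q -> f q != 0) -> chart_smooth f ->
  chart_smooth (fun q => (f q)^-1).
Proof.
move=> f0 sf k; apply: (CkV open_coords_image _ (sf k)).
by move=> _ [q cq <-] /=; rewrite point_atK// f0.
Qed.

Lemma chart_smooth_sqrt f : (forall q, dom c q -> 0 < f q) -> chart_smooth f ->
  chart_smooth (fun q => Num.sqrt (f q)).
Proof.
move=> f0 sf k; apply: (Ck_sqrt open_coords_image _ (sf k)).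
by move=> _ [q cq <-] /=; rewrite point_atK// f0.
Qed.

Lemma chart_smooth_sum (I : Type) (r : seq I) (P : pred I) (F : I -> T -> R) :
  (forall e, chart_smooth (F e)) -> chart_smooth (fun q => \sum_(e <- r | P e) F e q).
Proof.
move=> sF; elim: r => [|e r IH].
  by apply: eq_chart_smooth (chart_smooth_cst 0) => q _; rewrite big_nil.
case Pe: (P e); last by apply: eq_chart_smooth IH => q _; rewrite big_cons Pe.
by apply: eq_chart_smooth (chart_smoothD (sF e) IH) => q _; rewrite big_cons Pe.
Qed.

Lemma chart_smooth_prod (I : Type) (r : seq I) (P : pred I) (F : I -> T -> R) :
  (forall e, chart_smooth (F e)) -> chart_smooth (fun q => \prod_(e <- r | P e) F e q).
Proof.
move=> sF; elim: r => [|e r IH].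
  by apply: eq_chart_smooth (chart_smooth_cst 1) => q _; rewrite big_nil.
case Pe: (P e); last by apply: eq_chart_smooth IH => q _; rewrite big_cons Pe.
by apply: eq_chart_smooth (chart_smoothM (sF e) IH) => q _; rewrite big_cons Pe.
Qed.

Lemma chart_smooth_det m (M : T -> 'M[R]_m) :
  (forall a b, chart_smooth (fun q => M q a b)) -> chart_smooth (fun q => \det (M q)).
Proof.
move=> sM; rewrite /determinant; apply: chart_smooth_sum => s.
apply: chart_smoothM; first exact: chart_smooth_cst.
by apply: chart_smooth_prod => i; exact: sM.
Qed.

(** By Cramer's formula an entry of the inverse is a cofactor divided by the determinant, both
    polynomial in the entries of [M]. *)
Lemma chart_smooth_invmx m (M : T -> 'M[R]_m) :
  (forall q, dom c q -> M q \in unitmx) ->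
  (forall a b, chart_smooth (fun q => M q a b)) ->
  forall a b, chart_smooth (fun q => invmx (M q) a b).
Proof.
move=> uM sM a b.
have E q : dom c q -> (\det (M q))^-1 * ((-1) ^+ (b + a) * \det (row' b (col' a (M q))))
    = invmx (M q) a b.
  by move=> cq; rewrite /invmx uM// !mxE.
apply: eq_chart_smooth E _; apply: chart_smoothM.
  apply: chart_smoothV => [q cq|]; last exact: chart_smooth_det.
  by have := uM q cq; rewrite unitmxE unitfE.
apply: chart_smoothM; first exact: chart_smooth_cst.
apply: chart_smooth_det => k l; apply: eq_chart_smooth (sM (lift b k) (lift a l)).
by move=> q _; rewrite !mxE.
Qed.

Lemma pd_cst a i p : pd c i (fun=> a) p = 0.
Proof. by rewrite /pd /partial; exact: derive_cst. Qed.

Lemma pdD f g i p : chart_smooth f -> chart_smooth g -> dom c p ->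
  pd c i (fun q => f q + g q) p = pd c i f p + pd c i g p.
Proof.
by move=> sf sg cp; apply: deriveD; apply: chart_smooth_derivable.
Qed.

Lemma pdM f g i p : chart_smooth f -> chart_smooth g -> dom c p ->
  pd c i (fun q => f q * g q) p = pd c i f p * g p + f p * pd c i g p.
Proof.
move=> sf sg cp; rewrite /pd /partial.
rewrite (deriveM (chart_smooth_derivable sf cp) (chart_smooth_derivable sg cp)) /=.
by rewrite !(point_atK cp) addrC; congr (_ + _); exact: mulrC.
Qed.

Lemma pdZ f a i p : chart_smooth f -> dom c p ->
  pd c i (fun q => a * f q) p = a * pd c i f p.
Proof.
move=> sf cp; rewrite (pdM _ (chart_smooth_cst a)) // pd_cst mul0r add0r //.
Qed.

Lemma pdN f i p : chart_smooth f -> dom c p ->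
  pd c i (fun q => - f q) p = - pd c i f p.
Proof.
by move=> sf cp; apply: deriveN; apply: chart_smooth_derivable.
Qed.

Lemma pd_sum (I : Type) (r : seq I) (F : I -> T -> R) i p :
  (forall e, chart_smooth (F e)) -> dom c p ->
  pd c i (fun q => \sum_(e <- r) F e q) p = \sum_(e <- r) pd c i (F e) p.
Proof.
move=> sF cp; elim: r => [|e r IH].
  rewrite big_nil -[RHS](pd_cst 0 i p); apply: eq_pd => // q _; exact: big_nil.
rewrite big_cons -IH -pdD//; last exact: chart_smooth_sum.
by apply: eq_pd => // q _; rewrite big_cons.
Qed.

End ChartSmooth.

(** * Hessian, Laplacian and curvature *)

Section Geometry.
Variables (R : realType) (T : topologicalType) (n : nat) (A : atlas R T n).
Variables (h : tensor2 A) (c : chart A).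
Hypotheses (manA : smooth_manifold setT A) (riem : riemannian h).
Implicit Types (f u : T -> R) (p q : T) (i j k l m s t : 'I_n).

Local Notation "'d_ i" := (pd c i) (at level 8, i at level 2, format "''d_' i").
Local Notation G := (metric_inv h c).
Local Notation Gam := (christoffel h c).

Definition gradient f k p : R := \sum_j metric_inv h c p k j * pd c j f p.

Definition covd_gradient f l m p : R :=
  pd c l (gradient f m) p + \sum_s christoffel h c m l s p * gradient f s p.

Lemma metric_tensor_sym q i j : dom c q -> h c q i j = h c q j i.
Proof. by move=> cq; have [hT _] := riem.2 c q cq; rewrite -[in LHS]hT mxE. Qed.

(** A nonzero vector of the kernel would have zero length, against positive definiteness. *)
Lemma metric_unit q : dom c q -> h c q \in unitmx.
Proof.
move=> cq; have [_ pos] := riem.2 c q cq.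
rewrite -row_free_unit -kermx_eq0; apply/negPn/negP => /rowV0Pn[v].
rewrite sub_kermx => /eqP vh v0.
by have := pos v v0; rewrite vh mul0mx mxE ltxx.
Qed.

Lemma metric_inv_sym q i j : dom c q -> G q i j = G q j i.
Proof.
move=> cq; have [hT _] := riem.2 c q cq.
by rewrite /metric_inv -[in LHS]hT -trmx_inv mxE.
Qed.

Lemma metric_invK q i k : dom c q -> \sum_j h c q i j * G q j k = (i == k)%:R.
Proof.
by move=> /metric_unit /mulmxV /matrixP/(_ i k); rewrite !mxE.
Qed.

Lemma metric_smooth i j : chart_smooth c (fun q => h c q i j).
Proof. by apply: (smooth_on_chart_smooth manA); exact: riem.1.2. Qed.

Lemma metric_inv_smooth i j : chart_smooth c (fun q => G q i j).
Proof.
apply: (chart_smooth_invmx manA); first exact: metric_unit.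
by move=> a b; exact: metric_smooth.
Qed.

Lemma christoffel_smooth k i j : chart_smooth c (Gam k i j).
Proof.
apply: (chart_smoothM manA); first exact: (chart_smooth_cst (A := A) c).
apply: (chart_smooth_sum manA) => l; apply: (chart_smoothM manA).
  exact: metric_inv_smooth.
apply: (chart_smoothD manA); last apply: (chart_smoothN manA).
  by apply: (chart_smoothD manA); apply: (chart_smooth_pd manA); exact: metric_smooth.
by apply: (chart_smooth_pd manA); exact: metric_smooth.
Qed.

Lemma christoffel_sym k i j q : dom c q -> Gam k i j q = Gam k j i q.
Proof.
move=> cq; rewrite /christoffel; congr (_ * _); apply: eq_bigr => l _.
congr (_ * (_ - _)); first exact: addrC.
by apply: (eq_pd manA) => // q' cq'; exact: metric_tensor_sym.
Qed.

(** In this form the last two derivatives of the metric change sign when [m] and [k] are exchanged,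
    so they drop out of the symmetric sum in [pd_metric_inv]. *)
Lemma raised_christoffel m l k p : dom c p ->
  \sum_s Gam m l s p * G p s k = 2^-1 * \sum_a \sum_b G p m a * G p k b *
    ('d_l (fun q => h c q b a) p + 'd_b (fun q => h c q l a) p
     - 'd_a (fun q => h c q l b) p).
Proof.
move=> cp; rewrite exchange_big mulr_sumr; apply: eq_bigr => s _ /=.
rewrite /christoffel -mulrA; congr (_ * _); rewrite mulr_suml.
by apply: eq_bigr => a _; rewrite (metric_inv_sym s k cp); ring.
Qed.

(** This says that the inverse metric is parallel. Differentiating [h G = 1] gives [dG = - G dh G],
    which is compared with the symmetrized [raised_christoffel]. *)
Lemma pd_metric_inv l m k p : dom c p ->
  'd_l (fun q => G q m k) p
  = - \sum_s (Gam m l s p * G p s k + Gam k l s p * G p s m).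
Proof.
move=> cp.
pose Dh := \matrix_(a, b) 'd_l (fun q => h c q a b) p.
pose DG := \matrix_(a, b) 'd_l (fun q => G q a b) p.
have DhG : Dh *m G p + h c p *m DG = 0.
  apply/matrixP => a b; rewrite !mxE -big_split/= -[RHS](pd_cst c (a == b)%:R l p).
  have sF e : chart_smooth c (fun q => h c q a e * G q e b).
    by apply: (chart_smoothM manA); [exact: metric_smooth|exact: metric_inv_smooth].
  rewrite -(eq_pd manA (f := fun q => \sum_e h c q a e * G q e b)) //; last first.
    by move=> q cq; exact: metric_invK.
  rewrite (pd_sum manA) //; apply: eq_bigr => e _; rewrite !mxE.
  by rewrite (pdM manA _ (metric_smooth _ _) (metric_inv_smooth _ _)).
have -> : 'd_l (fun q => G q m k) p = - (G p *m Dh *m G p) m k.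
  have -> : 'd_l (fun q => G q m k) p = DG m k by rewrite mxE.
  have -> : DG = - (G p *m Dh *m G p); last by rewrite mxE.
  rewrite -mulmxA -mulmxN (addr0_eq DhG) mulmxA mulVmx ?mul1mx//.
  exact: metric_unit.
congr (- _); rewrite big_split/= !raised_christoffel// -mulrDr.
have -> : (G p *m Dh *m G p) m k = \sum_a \sum_b G p m a * Dh a b * G p b k.
  by rewrite mxE exchange_big; apply: eq_bigr => b _; rewrite mxE mulr_suml.
rewrite [X in _ * (_ + X)]exchange_big/= -big_split/= mulr_sumr.
apply: eq_bigr => a _; rewrite -big_split/= mulr_sumr; apply: eq_bigr => b _.
rewrite mxE (metric_inv_sym b k cp).
have -> : 'd_l (fun q => h c q b a) p = 'd_l (fun q => h c q a b) p.
  by apply: (eq_pd manA) => // q cq; exact: metric_tensor_sym.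
by field.
Qed.

Lemma gradient_smooth f m : chart_smooth c f -> chart_smooth c (gradient f m).
Proof.
move=> sf; apply: (chart_smooth_sum manA) => j; apply: (chart_smoothM manA).
  exact: metric_inv_smooth.
exact: (chart_smooth_pd manA).
Qed.

Lemma grad_dot_smooth f : chart_smooth c f -> chart_smooth c (grad_dot h c f f).
Proof.
move=> sf; have sd i : chart_smooth c ('d_i f) by exact: (chart_smooth_pd manA).
apply: (chart_smooth_sum manA) => i; apply: (chart_smooth_sum manA) => j.
by do 2![apply: (chart_smoothM manA) => //]; exact: metric_inv_smooth.
Qed.

Lemma covd_gradient_smooth f l m : chart_smooth c f ->
  chart_smooth c (covd_gradient f l m).
Proof.
move=> sf; apply: (chart_smoothD manA).
  by apply: (chart_smooth_pd manA); exact: gradient_smooth.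
apply: (chart_smooth_sum manA) => s; apply: (chart_smoothM manA).
  exact: christoffel_smooth.
exact: gradient_smooth.
Qed.

Lemma hessian_sym f p i j : chart_smooth c f -> dom c p ->
  hessian h c f p i j = hessian h c f p j i.
Proof.
move=> sf cp; rewrite !mxE (pdC manA i j sf cp); congr (_ - _).
by apply: eq_bigr => k _; rewrite christoffel_sym.
Qed.

(** Raising an index commutes with covariant differentiation: of the two Christoffel terms in the
    derivative of [G], one cancels the correction in [covd_gradient] and the other becomes that of
    the Hessian. *)
Lemma covd_gradientE f l m p : chart_smooth c f -> dom c p ->
  covd_gradient f l m p = \sum_k G p m k * hessian h c f p l k.
Proof.
move=> sf cp; rewrite /covd_gradient.
have -> : 'd_l (gradient f m) p = \sum_k ('d_l (fun q => G q m k) p * 'd_k f p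
    + G p m k * 'd_l ('d_k f) p).
  rewrite (pd_sum manA)// => [|k].
    by apply: eq_bigr => k _; apply: (pdM manA) => //;
      [exact: metric_inv_smooth|exact: (chart_smooth_pd manA)].
  by apply: (chart_smoothM manA); [exact: metric_inv_smooth|exact: (chart_smooth_pd manA)].
rewrite big_split/=.
under eq_bigr => k _ do rewrite pd_metric_inv// mulNr mulr_suml.
rewrite sumrN (eq_bigr (fun k => \sum_s (Gam m l s p * (G p s k * 'd_k f p)
  + Gam k l s p * G p m s * 'd_k f p))); last first.
  by move=> k _; apply: eq_bigr => s _; rewrite (metric_inv_sym s m cp); ring.
rewrite exchange_big/=.
under eq_bigr => s _ do rewrite big_split/= -mulr_sumr.
rewrite big_split/= /gradient.
under [RHS]eq_bigr => k _ do rewrite mxE mulrBr mulr_sumr.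
rewrite [RHS]big_split/= sumrN.
have -> : \sum_s \sum_i Gam i l s p * G p m s * 'd_i f p
   = \sum_i \sum_k G p m i * (Gam k l i p * 'd_k f p).
  by apply: eq_bigr => s _; apply: eq_bigr => k _; ring.
ring.
Qed.

Lemma laplacianE f p : chart_smooth c f -> dom c p ->
  laplacian h c f p = \sum_l covd_gradient f l l p.
Proof.
move=> sf cp; apply: eq_bigr => l _; rewrite covd_gradientE//.
Qed.

Lemma lower_gradient f s p : dom c p -> \sum_t h c p s t * gradient f t p = 'd_s f p.
Proof.
move=> cp; under eq_bigr => t _ do rewrite /gradient mulr_sumr.
rewrite exchange_big /= (bigD1 s)//= [X in _ + X]big1 => [|j js].
  under eq_bigr => t _ do rewrite mulrA.
  by rewrite -mulr_suml metric_invK// eqxx mul1r addr0.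
under eq_bigr => t _ do rewrite mulrA.
by rewrite -mulr_suml metric_invK// eq_sym (negbTE js) mul0r.
Qed.

Lemma hessian_gradient f k p : chart_smooth c f -> dom c p ->
  \sum_i hessian h c f p k i * gradient f i p
  = \sum_m covd_gradient f k m p * 'd_m f p.
Proof.
move=> sf cp; under [RHS]eq_bigr => m _ do rewrite covd_gradientE// mulr_suml.
rewrite [RHS]exchange_big; apply: eq_bigr => i _ /=.
by rewrite mulr_sumr; apply: eq_bigr => m _; rewrite (metric_inv_sym m i cp); ring.
Qed.

Lemma pd_grad_dot f k p : chart_smooth c f -> dom c p ->
  'd_k (grad_dot h c f f) p = 2 * \sum_m covd_gradient f k m p * 'd_m f p.
Proof.
move=> sf cp.
have E q : grad_dot h c f f q = \sum_i 'd_i f q * gradient f i q.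
  by apply: eq_bigr => i _; rewrite mulr_sumr; apply: eq_bigr => j _; ring.
have sd i : chart_smooth c ('d_i f) by exact: (chart_smooth_pd manA).
have sg i : chart_smooth c (gradient f i) by exact: gradient_smooth.
rewrite (eq_pd manA (g := fun q => \sum_i 'd_i f q * gradient f i q))//.
rewrite (pd_sum manA)//; last by move=> i; exact: (chart_smoothM manA).
under eq_bigr => i _ do rewrite (pdM manA)//.
(* Covariant derivatives replace the partial ones; the corrections in [E1] and [E2] are opposite,
   and the two covariant halves agree by [hessian_gradient]. *)
have E1 : \sum_i 'd_k ('d_i f) p * gradient f i p
    = \sum_i hessian h c f p k i * gradient f i p
      + \sum_i \sum_s Gam s k i p * 'd_s f p * gradient f i p.
  rewrite -big_split/=; apply: eq_bigr => i _.
  by rewrite mxE -mulr_suml -mulrDl subrK.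
have E2 : \sum_i 'd_i f p * 'd_k (gradient f i) p
    = \sum_i covd_gradient f k i p * 'd_i f p
      - \sum_i \sum_s Gam s k i p * 'd_s f p * gradient f i p.
  rewrite [X in _ - X]exchange_big -sumrB; apply: eq_bigr => i _ /=.
  rewrite /covd_gradient mulrDl mulr_suml -addrA -sumrB big1; last by move=> s _; ring.
  by rewrite addr0; exact: mulrC.
rewrite big_split/= E1 E2.
rewrite hessian_gradient//; ring.
Qed.

(* Stated for the vector field grad f rather than for the form df, the Ricci
   identity traced over [l] yields the Ricci tensor directly, without the
   antisymmetry of the curvature in its first pair of indices. *)
Lemma ricci_identity f s p : chart_smooth c f -> dom c p ->
  \sum_l 'd_l (covd_gradient f s l) p
  = 'd_s (fun q => \sum_l covd_gradient f l l q) p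
    + \sum_t ricci h c p t s * gradient f t p
    + \sum_l \sum_t Gam l s t p * covd_gradient f l t p
    - \sum_l \sum_t Gam l l t p * covd_gradient f s t p.
Proof.
move=> sf cp.
have rearrange (x1 x2 x3 y1 y2 y3 : R) : x1 + x2 - x3
    = y1 + y2 - y3 + (x1 - y1 + (y3 + (- x3 + (x2 - y2)))) by ring.
have sg i : chart_smooth c (gradient f i) by exact: gradient_smooth.
(* First derivatives of the gradient are eliminated in favour of [covd_gradient], which separates
   the quadratic Christoffel terms of the curvature. *)
have D a b l : 'd_a (covd_gradient f b l) p = 'd_a ('d_b (gradient f l)) p
    + \sum_t ('d_a (Gam l b t) p * gradient f t p
              + Gam l b t p * (covd_gradient f a t p
                  - \sum_k Gam t a k p * gradient f k p)).
  have sGg t : chart_smooth c (fun q => Gam l b t q * gradient f t q).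
    by apply: (chart_smoothM manA) => //; exact: christoffel_smooth.
  have sd : chart_smooth c ('d_b (gradient f l)) by exact: (chart_smooth_pd manA).
  have sS : chart_smooth c (fun q => \sum_t Gam l b t q * gradient f t q).
    exact: (chart_smooth_sum manA).
  rewrite [LHS](pdD _ sd sS cp) (pd_sum manA _ _ sGg cp).
  congr (_ + _); apply: eq_bigr => t _.
  rewrite (pdM manA _ (christoffel_smooth _ _ _) (sg t) cp).
  by congr (_ + _ * _); rewrite /covd_gradient addrK.
rewrite (pd_sum manA)//; last by move=> l; exact: covd_gradient_smooth.
have -> : \sum_t ricci h c p t s * gradient f t p
    = \sum_l \sum_t ('d_l (Gam l s t) p - 'd_s (Gam l l t) p) * gradient f t p
     + \sum_l (\sum_t \sum_k Gam l l k p * Gam k s t p * gradient f t p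
       - \sum_t \sum_k Gam l s k p * Gam k l t p * gradient f t p).
  under eq_bigr => t _ do rewrite mxE mulr_suml.
  rewrite exchange_big -big_split/=; apply: eq_bigr => l _.
  rewrite -sumrB -big_split/=; apply: eq_bigr => t _.
  by rewrite /riemann mulrDl -mulr_suml -mulr_suml -mulrBl sumrB.
rewrite -!big_split/= -sumrB; apply: eq_bigr => l _.
(* The second partials of the gradient agree on both sides by symmetry and are discarded. *)
rewrite !D (pdC manA s l (sg l) cp) -!addrA; congr (_ + _).
have X a b : \sum_t ('d_a (Gam l b t) p * gradient f t p
              + Gam l b t p * (covd_gradient f a t p
                  - \sum_k Gam t a k p * gradient f k p))
   = \sum_t 'd_a (Gam l b t) p * gradient f t p
     + \sum_t Gam l b t p * covd_gradient f a t p
     - \sum_t \sum_k Gam l b k p * Gam k a t p * gradient f t p.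
  rewrite [X in _ - X]exchange_big -big_split/= -sumrB; apply: eq_bigr => t _ /=.
  rewrite mulrBr addrA; congr (_ - _); rewrite mulr_sumr; apply: eq_bigr => k _; ring.
rewrite !X.
have -> : \sum_t ('d_l (Gam l s t) p - 'd_s (Gam l l t) p) * gradient f t p
   = \sum_t 'd_l (Gam l s t) p * gradient f t p
     - \sum_t 'd_s (Gam l l t) p * gradient f t p.
  by rewrite -sumrB; apply: eq_bigr => t _; rewrite mulrBl.
exact: rearrange.
Qed.

(** This turns the fourfold sum into matrix algebra, where the square of [Hess u - u h] expands by
    means of [h G = 1]. *)
Lemma tensor_normsqE (B : 'M[R]_n) p : dom c p -> B^T = B ->
  tensor_normsq h c B p = \tr ((B *m G p) *m (B *m G p)).
Proof.
move=> cp BT; have Bsym i j : B i j = B j i by rewrite -[in LHS]BT mxE.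
rewrite /mxtrace /tensor_normsq; apply: eq_bigr => i _; rewrite mxE exchange_big.
have -> : \sum_j (B *m G p) i j * (B *m G p) j i
    = \sum_j (\sum_k B i k * G p k j) * (\sum_l B j l * G p l i).
  by apply: eq_bigr => j _; rewrite !mxE.
under [RHS]eq_bigr => j _ do rewrite mulr_sumr.
rewrite [RHS]exchange_big; apply: eq_bigr => k _ /=.
rewrite exchange_big; apply: eq_bigr => l _ /=.
rewrite mulr_suml; apply: eq_bigr => j _.
by rewrite (metric_inv_sym i k cp) (Bsym k l); ring.
Qed.

End Geometry.

(** * The Laplacian of u^2 - |grad u|^2 - 1 *)

(* Cancellation of the Christoffel symbols in div (2 v x - 2 e x), where
   [e s l], [de s l], [du l] and [ds s] stand for E_s^l, d_l E_s^l, d_l u and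
   d_s (tr E). *)
Lemma divergence_algebra (R : comNzRingType) (n : nat)
    (e de ric : 'I_n -> 'I_n -> R) (gam : 'I_n -> 'I_n -> 'I_n -> R) (x du ds : 'I_n -> R) (v : R) :
  (forall l s t, gam l s t = gam l t s) ->
  (forall s, \sum_l de s l = ds s + \sum_t ric t s * x t
     + \sum_l \sum_t gam l s t * e l t - \sum_l \sum_t gam l l t * e s t) ->
  \sum_l (2 * (du l * x l + v * (e l l - \sum_t gam l l t * x t))
           - 2 * \sum_s (de s l * x s + e s l * (e l s - \sum_t gam s l t * x t))
           + \sum_s gam l l s * (2 * v * x s - 2 * \sum_t e t s * x t))
  = 2 * \sum_l du l * x l + 2 * v * \sum_l e l l - 2 * \sum_s ds s * x s
    - 2 * \sum_s \sum_t ric t s * x t * x s - 2 * \sum_l \sum_s e s l * e l s.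
Proof.
move=> gam_sym de_trace.
(* [a] appears with both signs. Expanding [b] by the trace hypothesis gives [f - g], which cancels
   the [f] of the product rule and the [g] of the divergence. *)
pose a := \sum_l \sum_t gam l l t * x t.
pose b := \sum_l \sum_s de s l * x s.
pose f := \sum_l \sum_s \sum_t e s l * gam s l t * x t.
pose g := \sum_l \sum_s \sum_t gam l l s * e t s * x t.
have bE : b = \sum_s ds s * x s + \sum_s \sum_t ric t s * x t * x s + f - g.
  have -> : f = \sum_s (\sum_l \sum_t gam l s t * e l t) * x s.
    under [RHS]eq_bigr => s _ do rewrite mulr_suml.
    rewrite [RHS]exchange_big /f [LHS]exchange_big; apply: eq_bigr => l _ /=.
    under [RHS]eq_bigr => s _ do rewrite mulr_suml.
    rewrite [RHS]exchange_big; apply: eq_bigr => t _ /=.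
    by apply: eq_bigr => s _; rewrite (gam_sym l t s); ring.
  have -> : g = \sum_s (\sum_l \sum_t gam l l t * e s t) * x s.
    under [RHS]eq_bigr => s _ do rewrite mulr_suml.
    rewrite [RHS]exchange_big; apply: eq_bigr => l _ /=.
    under [RHS]eq_bigr => s _ do rewrite mulr_suml.
    by rewrite [RHS]exchange_big.
  rewrite /b exchange_big -!big_split -sumrB; apply: eq_bigr => s _ /=.
  by rewrite -mulr_suml de_trace -mulr_suml; ring.
have -> : \sum_l (2 * (du l * x l + v * (e l l - \sum_t gam l l t * x t))
           - 2 * \sum_s (de s l * x s + e s l * (e l s - \sum_t gam s l t * x t))
           + \sum_s gam l l s * (2 * v * x s - 2 * \sum_t e t s * x t))
  = 2 * \sum_l du l * x l + 2 * v * \sum_l e l l - 2 * v * a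
    - 2 * b - 2 * \sum_l \sum_s e s l * e l s + 2 * f + 2 * v * a - 2 * g.
  rewrite !mulr_sumr -!sumrN -!big_split; apply: eq_bigr => l _ /=.
  have -> : \sum_s (de s l * x s + e s l * (e l s - \sum_t gam s l t * x t))
     = \sum_s de s l * x s + \sum_s e s l * e l s
       - \sum_s \sum_t e s l * gam s l t * x t.
    rewrite -big_split -sumrB; apply: eq_bigr => s _ /=.
    rewrite mulrBr addrA mulr_sumr; congr (_ - _).
    by apply: eq_bigr => t _; rewrite mulrA.
  have -> : \sum_s gam l l s * (2 * v * x s - 2 * \sum_t e t s * x t)
     = 2 * v * (\sum_s gam l l s * x s) - 2 * \sum_s \sum_t gam l l s * e t s * x t.
    rewrite !mulr_sumr -sumrB; apply: eq_bigr => s _ /=.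
    have -> : \sum_t gam l l s * e t s * x t = gam l l s * \sum_t e t s * x t.
      by rewrite mulr_sumr; apply: eq_bigr => t _; rewrite mulrA.
    by ring.
  by ring.
by rewrite bE; ring.
Qed.


(** It vanishes identically in the model case of hyperbolic space with [u = sqrt (1 + r^2)]. Writing
    [u ^+ 2] for [V] leaves [u] as the only function to differentiate. *)
Definition energy_defect (R : realType) (T : topologicalType) (n : nat)
    (A : atlas R T n) (h : tensor2 A) (c : chart A) (u : T -> R) (q : T) : R :=
  u q ^+ 2 - grad_dot h c u u q - 1.

Section EnergyDefect.
Variables (R : realType) (T : topologicalType) (n : nat) (A : atlas R T n).
Variables (h : tensor2 A) (c : chart A) (u : T -> R).
Hypotheses (manA : smooth_manifold setT A) (riem : riemannian h).
Hypothesis su : chart_smooth c u.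

Local Notation "'d_ i" := (pd c i) (at level 8, i at level 2, format "''d_' i").
Local Notation G := (metric_inv h c).
Local Notation Gam := (christoffel h c).
Local Notation X := (gradient h c u).
Local Notation E := (covd_gradient h c u).
Local Notation W := (energy_defect h c u).

Lemma energy_defect_smooth : chart_smooth c W.
Proof.
have sg := grad_dot_smooth manA riem su.
apply: (chart_smoothD manA); last exact: (chart_smooth_cst (A := A) c).
apply: (chart_smoothD manA); last exact: (chart_smoothN manA).
exact: (chart_smoothM manA).
Qed.

Lemma pd_energy_defect k p : dom c p ->
  'd_k W p = 2 * u p * 'd_k u p - 2 * \sum_m E k m p * 'd_m u p.
Proof.
move=> cp.
have sg := grad_dot_smooth manA riem su.
have suu : chart_smooth c (fun q => u q * u q) by exact: (chart_smoothM manA).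
have sB := chart_smoothD manA suu (chart_smoothN manA sg).
rewrite [LHS](pdD k sB (chart_smooth_cst (A := A) c (-1)) cp) pd_cst addr0.
rewrite (pdD k suu (chart_smoothN manA sg) cp) (pdN k sg cp).
rewrite (pdM manA k su su cp) (pd_grad_dot manA riem k su cp).
by congr (_ - _); ring.
Qed.

Lemma gradient_energy_defect l p : dom c p ->
  gradient h c W l p = 2 * u p * X l p - 2 * \sum_s E s l p * X s p.
Proof.
move=> cp; rewrite {1}/gradient.
under eq_bigr => k _ do rewrite (pd_energy_defect k cp) mulrBr.
rewrite sumrB; congr (_ - _).
  by rewrite mulr_sumr; apply: eq_bigr => k _; ring.
(* Both sides are brought to [G^lk G^sm Hess_ks d_m u]; the symmetry of the Hessian places the
   raised index on the required slot. *)
have -> : \sum_s E s l p * X s p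
    = \sum_s (\sum_k G p l k * hessian h c u p k s) * (\sum_m G p s m * 'd_m u p).
  apply: eq_bigr => s _; rewrite (covd_gradientE manA riem _ _ su cp).
  congr (_ * _); apply: eq_bigr => k _; congr (_ * _).
  exact: (hessian_sym manA riem _ _ su cp).
have -> : \sum_k G p l k * (2 * \sum_m E k m p * 'd_m u p)
    = 2 * \sum_k \sum_m \sum_s G p l k * (G p m s * hessian h c u p k s * 'd_m u p).
  rewrite mulr_sumr; apply: eq_bigr => k _; rewrite mulrCA; congr (_ * _).
  rewrite mulr_sumr; apply: eq_bigr => m _.
  by rewrite (covd_gradientE manA riem _ _ su cp) mulr_suml mulr_sumr.
congr (_ * _).
under [RHS]eq_bigr => s _ do rewrite mulr_suml.
rewrite [RHS]exchange_big; apply: eq_bigr => k _ /=.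
rewrite exchange_big; apply: eq_bigr => s _ /=.
rewrite mulr_sumr; apply: eq_bigr => m _; rewrite (metric_inv_sym riem m s cp); ring.
Qed.

(** This is Bochner's formula for [|grad u|^2] combined with the Laplacian of [u^2]. It holds for
    every smooth [u]; the static equations enter only afterwards. *)
Lemma laplacian_energy_defect p : dom c p ->
  laplacian h c W p = 2 * \sum_l 'd_l u p * X l p + 2 * u p * laplacian h c u p
    - 2 * \sum_s 'd_s (laplacian h c u) p * X s p
    - 2 * \sum_s \sum_t ricci h c p t s * X t p * X s p
    - 2 * \sum_l \sum_s E s l p * E l s p.
Proof.
move=> cp; rewrite (laplacianE manA riem energy_defect_smooth cp).
have sX m : chart_smooth c (X m) by exact: (gradient_smooth manA riem).
have sE l m : chart_smooth c (E l m) by exact: (covd_gradient_smooth manA riem).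
have sEX l s : chart_smooth c (fun q => E s l q * X s q) by exact: (chart_smoothM manA).
have suX l : chart_smooth c (fun q => u q * X l q) by exact: (chart_smoothM manA).
have dX s l : 'd_l (X s) p = E l s p - \sum_t Gam s l t p * X t p.
  by rewrite /covd_gradient addrK.
have dY l : 'd_l (gradient h c W l) p
    = 2 * ('d_l u p * X l p + u p * (E l l p - \sum_t Gam l l t p * X t p))
      - 2 * \sum_s ('d_l (E s l) p * X s p
                    + E s l p * (E l s p - \sum_t Gam s l t p * X t p)).
  have sS := chart_smooth_sum manA (index_enum 'I_n) xpredT (sEX l).
  have s1 : chart_smooth c (fun q => 2 * (u q * X l q)).
    by apply: (chart_smoothM manA) => //; exact: (chart_smooth_cst (A := A) c).
  have s2 : chart_smooth c (fun q => 2 * \sum_s E s l q * X s q).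
    by apply: (chart_smoothM manA) => //; exact: (chart_smooth_cst (A := A) c).
  rewrite (eq_pd manA
    (g := fun q => 2 * (u q * X l q) - 2 * \sum_s E s l q * X s q) _ _ cp);
    last by move=> q cq; rewrite (gradient_energy_defect l cq) mulrA.
  rewrite (pdD l s1 (chart_smoothN manA s2) cp) (pdN l s2 cp).
  rewrite (pdZ manA 2 l (suX l) cp) (pdZ manA 2 l sS cp).
  rewrite (pdM manA l su (sX l) cp) dX (pd_sum manA _ l (sEX l) cp).
  congr (_ - 2 * _); apply: eq_bigr => s _.
  by rewrite (pdM manA l (sE s l) (sX s) cp) dX.
have -> : \sum_l covd_gradient h c W l l p
    = \sum_l (2 * ('d_l u p * X l p + u p * (E l l p - \sum_t Gam l l t p * X t p))
      - 2 * \sum_s ('d_l (E s l) p * X s p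
                    + E s l p * (E l s p - \sum_t Gam s l t p * X t p))
      + \sum_s Gam l l s p * (2 * u p * X s p - 2 * \sum_t E t s p * X t p)).
  apply: eq_bigr => l _; rewrite {1}/covd_gradient dY; congr (_ + _).
  by apply: eq_bigr => s _; rewrite gradient_energy_defect.
rewrite (laplacianE manA riem su cp).
pose ds s := 'd_s (fun q => \sum_l E l l q) p.
have dsE s : 'd_s (laplacian h c u) p = ds s.
  by apply: (eq_pd manA) => // q cq; exact: laplacianE.
under [X in _ - 2 * X - _ - _]eq_bigr => s _ do rewrite dsE.
apply: (@divergence_algebra R n (fun a b => E a b p) (fun a b => 'd_b (E a b) p)
  (fun a b => ricci h c p a b) (fun a b d => Gam a b d p) (fun a => X a p)
  (fun a => 'd_a u p) ds (u p)) => [l s t|s].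
  exact: (christoffel_sym manA riem).
exact: (ricci_identity manA riem).
Qed.

End EnergyDefect.

Theorem lemma1p3 (R : realType) (n k : nat) (G : R)
    (Sigma : topologicalType) (A : atlas R Sigma n)
    (h : tensor2 A) (V : Sigma -> R) :
  (2 <= n)%N ->
  smooth_manifold setT A ->
  riemannian h ->
  smooth_fun A V ->
  (forall p, 0 < V p) ->
  asymptotically_AdS k G (static_metric V h) ->
  let u := fun p => Num.sqrt (V p) in
  (forall (c : chart A) p, dom c p -> laplacian h c u p = n%:R * u p) ->
  (forall (c : chart A) p, dom c p ->
     ricci h c p + n%:R *: h c p = (u p)^-1 *: hessian h c u p) ->
  forall (c : chart A) p, dom c p ->
    let W := fun q => V q - grad_dot h c u u q - 1 in
    - laplacian h c W p
    = 2 * tensor_normsq h c (hessian h c u p - u p *: h c p) p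
      - (u p)^-1 * grad_dot h c u W p.
Proof.
move=> _ manA riem smV V_gt0 _ u lap_u ric_u c p cp W.
have su : chart_smooth c u.
  by apply: (chart_smooth_sqrt manA) => //; exact: (smooth_on_chart_smooth manA).
have u0 : u p != 0 by rewrite gt_eqF// sqrtr_gt0.
have -> : W = energy_defect h c u.
  by apply/funext => q; rewrite /energy_defect sqr_sqrtr// ltW.
rewrite (laplacian_energy_defect manA riem su cp) lap_u//.
pose X m := gradient h c u m p.
pose E l m := covd_gradient h c u l m p.
(* [a] is [|grad u|^2] and [b] is [Hess u (grad u, grad u)]. *)
pose a := \sum_l pd c l u p * X l.
pose b := \sum_s \sum_m E s m * pd c m u p * X s.
have -> : \sum_s pd c s (laplacian h c u) p * gradient h c u s p = n%:R * a.
  rewrite mulr_sumr; apply: eq_bigr => s _; rewrite mulrA; congr (_ * _).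
  rewrite -(pdZ manA n%:R s su cp); apply: (eq_pd manA) => // q cq; exact: lap_u.
have -> : \sum_s \sum_t ricci h c p t s * gradient h c u t p * gradient h c u s p
    = (u p)^-1 * b - n%:R * a.
  rewrite /a /b [X in X - _]mulr_sumr [X in _ - X]mulr_sumr -sumrB.
  apply: eq_bigr => s _; rewrite -/(X s).
  rewrite -[LHS]mulr_suml -[in RHS]mulr_suml [X in X * _ = _](_ : _ =
      (u p)^-1 * (\sum_m E s m * pd c m u p) - n%:R * pd c s u p).
    by ring.
  rewrite -(hessian_gradient manA riem s su cp) -(lower_gradient riem u s cp).
  rewrite !mulr_sumr -sumrB; apply: eq_bigr => t _; rewrite !mulrA -mulrBl.
  congr (_ * _); rewrite (hessian_sym manA riem s t su cp).
  rewrite (metric_tensor_sym riem s t cp).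
  by have /matrixP/(_ t s) := ric_u c p cp; rewrite !mxE => <-; rewrite addrK.
have -> : grad_dot h c u (energy_defect h c u) p
    = 2 * u p * a - 2 * b.
  have -> : grad_dot h c u (energy_defect h c u) p
      = \sum_l pd c l u p * (2 * u p * X l - 2 * \sum_s E s l * X s).
    apply: eq_bigr => l _; rewrite -(gradient_energy_defect manA riem su l cp) mulr_sumr.
    by apply: eq_bigr => j _; rewrite mulrAC mulrC.
  rewrite /b [X in _ - 2 * X]exchange_big !mulr_sumr -sumrB; apply: eq_bigr => l _ /=.
  rewrite mulrBr mulrCA; congr (_ - _); rewrite mulrCA; congr (_ * _).
  by rewrite mulr_sumr; apply: eq_bigr => s _; ring.
pose Em := \matrix_(i, j) E i j.
(* With [Em] in hand, [|Hess u - u h|^2] is the trace of the square of [Em - u], and the Laplace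
   equation fixes [\tr Em]. *)
have HG : hessian h c u p *m metric_inv h c p = Em.
  apply/matrixP => i j; rewrite !mxE; rewrite /E (covd_gradientE manA riem i j su cp).
  by apply: eq_bigr => t _; rewrite (metric_inv_sym riem j t cp) mulrC.
have trE : \tr Em = n%:R * u p.
  rewrite -(lap_u c p cp) (laplacianE manA riem su cp); apply: eq_bigr => l _.
  by rewrite mxE.
have trEE : \tr (Em *m Em) = \sum_l \sum_s E s l * E l s.
  by apply: eq_bigr => l _; rewrite mxE; apply: eq_bigr => s _; rewrite !mxE mulrC.
have -> : tensor_normsq h c (hessian h c u p - u p *: h c p) p
    = \sum_l \sum_s E s l * E l s - n%:R * u p ^+ 2.
  rewrite (tensor_normsqE riem cp); last first.
    rewrite linearB linearZ/= (riem.2 c p cp).1; congr (_ - _).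
    by apply/matrixP => i j; rewrite mxE; exact: (hessian_sym manA riem j i su cp).
  rewrite mulmxBl HG -scalemxAl mulmxV ?(metric_unit riem)// scalemx1.
  rewrite mulmxBl !mulmxBr mul_scalar_mx mul_mx_scalar mul_scalar_mx.
  by rewrite scale_scalar_mx !raddfB/= !mxtraceZ mxtrace_scalar trEE trE -mulr_natl; ring.
(* The terms in [n a] cancel on the left; both sides equal [2 (tr E^2 - n u^2) - 2 a + 2 b / u]. *)
rewrite -/a; field.
exact: u0.
Qed.
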